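(* Let $\theta\in [0,1)$ and define $$\nu_\theta(z) := \sum_{n=1}^\infty \frac{2z}{1+z^2(n-\theta)^2}, \qquad z\in (0,\infty),$$ and $$\bar{\nu}_\theta := \sup_{z\in (0,1/(1-\theta)]} \nu_\theta(z).$$ Then $\bar{\nu}_\theta = \sup_{z\in (0,1/(1-\theta))} \nu_\theta(z)$ and $\mu(\theta) = 1/\bar{\nu}_\theta$. In addition, $$\bar{\nu}_\theta = \pi \quad\text{if and only if}\quad \theta\in [0,1/2].$$ More precisely: (i) for $\theta\in [0,1/2]$, there holds $J_\theta[\mathbf{a}]>\mu(\theta)=1/\pi$ for all $\mathbf{a}\in\mathcal{D}_1$; (ii) for $\theta\in (1/2,1)$, $\mu(\theta)<1/\pi$ and the set $$\mathcal{S}_\theta := \{z\in (0,1/(1-\theta))\ :\ \nu_\theta(z)=\bar{\nu}_\theta\}$$ is not empty. Furthermore, for $\mathbf{a}\in\mathcal{D}_1$, $J_\theta[\mathbf{a}]= \mu(\theta)$ if and only if there is $Z\in \mathcal{S}_\theta$ such that $\mathbf{a}=\boldsymbol{\varphi}_Z$, where, for $z>0$, $\boldsymbol{\varphi}_z = (\varphi_{n,z})_{n\ge 1}$ is the sequence defined by $$\varphi_{n,z} := \frac{2}{\nu_\theta(z)} \frac{z}{1+z^2 (n-\theta)^2}, \qquad n\ge 1.$$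
   Context: Let $$\mathcal{D}_1 := \left\{ \mathbf{a}=(a_n)_{n\ge 1}\ :\ a_n\ge 0 \text{ for all } n\ge 1,\ \sum_{n=1}^\infty a_n =1,\ \sum_{n=1}^\infty n^2 a_n^2 < \infty \right\}$$ (real sequences). For $\theta\in[0,1)$ and $\mathbf{a}\in\mathcal{D}_1$, $$J_\theta[\mathbf{a}] := \left( \sum_{n=1}^\infty a_n^2 \right)^{1/2} \left( \sum_{n=1}^\infty ( n - \theta )^2 a_n^2 \right)^{1/2}, \qquad \mu(\theta) := \inf_{\mathbf{a}\in\mathcal{D}_1} J_\theta[\mathbf{a}].$$ *)

(* Defs.v *)
From Stdlib Require Import Reals.
From Coquelicot Require Import Coquelicot.
Open Scope R_scope.

(* A sequence (a_n)_{n >= 1} is a function nat -> R whose value at 0 is ignored: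
   every sum below is over the indices S k, and two such sequences are equal
   when they agree at all n >= 1. *)
Definition seq_eq (a b : nat -> R) : Prop :=
  forall n : nat, (1 <= n)%nat -> a n = b n.

Definition sum1 (u : nat -> R) : R := Series (fun k => u (S k)).

Definition D1 (a : nat -> R) : Prop :=
  (forall n : nat, (1 <= n)%nat -> 0 <= a n) /\
  is_series (fun k => a (S k)) 1 /\
  ex_series (fun k => INR (S k) ^ 2 * a (S k) ^ 2).

(* [Series] is total and real-valued; both series converge when [D1 a] and
   0 <= theta < 1, and so does the one defining [nu] for 0 < z. *)
Definition J (theta : R) (a : nat -> R) : R :=
  sqrt (sum1 (fun n => a n ^ 2)) *
  sqrt (sum1 (fun n => (INR n - theta) ^ 2 * a n ^ 2)).

(* Infima and suprema are taken in the extended reals [Rbar], so that no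
   boundedness is presupposed. *)
Definition mu (theta : R) : Rbar :=
  Glb_Rbar (fun y => exists a : nat -> R, D1 a /\ y = J theta a).

Definition nu (theta z : R) : R :=
  sum1 (fun n => 2 * z / (1 + z ^ 2 * (INR n - theta) ^ 2)).

Definition nubar (theta : R) : Rbar :=
  Lub_Rbar (fun y => exists z : R, 0 < z <= 1 / (1 - theta) /\ y = nu theta z).

Definition maximizer (theta z : R) : Prop :=
  0 < z < 1 / (1 - theta) /\ Finite (nu theta z) = nubar theta.

Definition phi (theta z : R) (n : nat) : R :=
  2 / nu theta z * (z / (1 + z ^ 2 * (INR n - theta) ^ 2)).

(* Main.v *)
(** Write [x_n = n - theta], [A = sum a_n^2] and [B = sum x_n^2 a_n^2]. Completing
    the square with the weights [1 + z^2 x_n^2] gives, for every [z > 0],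
    [sum (1 + z^2 x_n^2) (a_n - phi_{n,z})^2 = A + z^2 B - 2 z / nu(z)], and at
    [Z = sqrt (A / B) <= 1 / (1 - theta)] the right-hand side is
    [2 Z (J[a] - 1 / nu(Z))]. Hence [J[a] >= 1 / nu(Z)], with equality exactly when
    [a = phi_Z]; conversely [a = phi_z] yields [J[phi_z] <= 1 / nu(z)] by AM-GM.
    What remains is to locate the supremum of [nu]. For [theta <= 1/2],
    [nu_theta <= nu_{1/2}], and Bessel's inequality for [exp (t / z)] on [-PI, PI]
    bounds [nu_{1/2}] by [PI tanh (PI / z) < PI]. Comparison of the sum with
    differences of [atan] gives [nu(z) -> PI] as [z -> 0], and values above [PI]
    near [0] when [theta > 1/2]; then a maximum is attained, and not at
    [1 / (1 - theta)], where [nu] is strictly decreasing. *)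
Require Import Defs.
From Stdlib Require Import Reals Lra Lia.
From Coquelicot Require Import Coquelicot.
Open Scope R_scope.

(** * Partial sums and series with nonnegative terms *)

Lemma sum_n_succ (u : nat -> R) (N : nat) : sum_n u (S N) = sum_n u N + u (S N).
Proof. exact (sum_Sn u N). Qed.

Lemma sum_n_zero (u : nat -> R) : sum_n u 0 = u 0%nat.
Proof. exact (sum_O u). Qed.

Lemma is_lim_sum_n (u : nat -> R) :
  ex_series u -> is_lim_seq (sum_n u) (Series u).
Proof. intros H. exact (Series_correct u H). Qed.

Lemma sum_n_le_Series (u : nat -> R) (N : nat) :
  (forall n, 0 <= u n) -> ex_series u -> sum_n u N <= Series u.
Proof.
  intros Hu Hex.
  apply (is_lim_seq_incr_compare (sum_n u) (Series u)).
  - now apply is_lim_sum_n.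
  - intros n. rewrite sum_n_succ. specialize (Hu (S n)). lra.
Qed.

Lemma term_le_sum_n (u : nat -> R) (N : nat) :
  (forall n, 0 <= u n) -> u N <= sum_n u N.
Proof.
  intros Hu.
  assert (Hpos : forall M, 0 <= sum_n u M).
  { induction M as [|M IH].
    - rewrite sum_n_zero. apply Hu.
    - rewrite sum_n_succ. specialize (Hu (S M)). lra. }
  destruct N as [|N].
  - rewrite sum_n_zero. lra.
  - rewrite sum_n_succ. specialize (Hpos N). lra.
Qed.

Lemma term_le_Series (u : nat -> R) (N : nat) :
  (forall n, 0 <= u n) -> ex_series u -> u N <= Series u.
Proof.
  intros Hu Hex.
  apply Rle_trans with (sum_n u N).
  - now apply term_le_sum_n.
  - now apply sum_n_le_Series.
Qed.

Lemma ex_series_of_bounded (u : nat -> R) (M : R) :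
  (forall n, 0 <= u n) -> (forall N, sum_n u N <= M) ->
  ex_series u /\ Series u <= M.
Proof.
  intros Hu HM.
  assert (Hfin : ex_finite_lim_seq (sum_n u)).
  { apply ex_finite_lim_seq_incr with M; [|exact HM].
    intros n. rewrite sum_n_succ. specialize (Hu (S n)). lra. }
  assert (Hex : ex_series u).
  { destruct Hfin as [l Hl]. exists l. exact Hl. }
  split; [exact Hex|].
  apply (is_lim_seq_le (sum_n u) (fun _ => M) (Series u) M HM).
  - now apply is_lim_sum_n.
  - apply is_lim_seq_const.
Qed.

(** * Bessel's inequality and the bound at theta = 1/2 *)

(** Projections onto the [e n] are subtracted one at a time: each lowers the squared norm of the
    residual by [p n ^ 2 / w n], and what is left is the integral of a square. The family is not
    normalised, hence the division by [w n]. *)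
Lemma bessel_inequality (a b F : R) (f : R -> R) (e : nat -> R -> R) (p w : nat -> R) :
  a <= b ->
  is_RInt (fun t => f t * f t) a b F ->
  (forall n, is_RInt (fun t => f t * e n t) a b (p n)) ->
  (forall m n, m <> n -> is_RInt (fun t => e m t * e n t) a b 0) ->
  (forall n, is_RInt (fun t => e n t * e n t) a b (w n)) ->
  (forall n, 0 < w n) ->
  forall N, sum_n (fun n => p n ^ 2 / w n) N <= F.
Proof.
  intros Hab HF Hp Horth Hw Hwpos.
  (* One projection; by orthogonality it leaves the coefficients of later index unchanged. *)
  assert (step : forall N r G,
    is_RInt (fun t => r t * r t) a b G ->
    (forall m, (N <= m)%nat -> is_RInt (fun t => r t * e m t) a b (p m)) ->
    let r' := fun t => r t - p N / w N * e N t in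
    is_RInt (fun t => r' t * r' t) a b (G - p N ^ 2 / w N) /\
    (forall m, (S N <= m)%nat -> is_RInt (fun t => r' t * e m t) a b (p m))).
  { intros N r G HG Hr r'. split.
    - assert (H := is_RInt_plus _ _ a b _ _ HG
        (is_RInt_plus _ _ a b _ _
          (is_RInt_scal _ a b (- (2 * (p N / w N))) _ (Hr N (le_n N)))
          (is_RInt_scal _ a b ((p N / w N) ^ 2) _ (Hw N)))).
      replace (G - p N ^ 2 / w N) with
        (plus G (plus (scal (- (2 * (p N / w N))) (p N))
                      (scal ((p N / w N) ^ 2) (w N)))).
      + eapply is_RInt_ext; [|exact H].
        intros t _. unfold r', plus, scal; simpl; unfold mult; simpl. ring.
      + unfold plus, scal; simpl; unfold mult; simpl.
        field. specialize (Hwpos N). lra.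
    - intros m Hm.
      assert (H := is_RInt_plus _ _ a b _ _ (Hr m ltac:(lia))
          (is_RInt_scal _ a b (- (p N / w N)) _ (Horth N m ltac:(lia)))).
      replace (p m) with (plus (p m) (scal (- (p N / w N)) 0)).
      + eapply is_RInt_ext; [|exact H].
        intros t _. unfold r', plus, scal; simpl; unfold mult; simpl. ring.
      + unfold plus, scal; simpl; unfold mult; simpl. ring. }
  assert (main : forall N, exists r : R -> R,
    is_RInt (fun t => r t * r t) a b (F - sum_n (fun n => p n ^ 2 / w n) N) /\
    (forall m, (S N <= m)%nat -> is_RInt (fun t => r t * e m t) a b (p m))).
  { induction N as [|N [r [H1 H2]]].
    - destruct (step 0%nat f F HF (fun m _ => Hp m)) as [H1 H2].
      rewrite sum_n_zero. eexists. split; [exact H1|exact H2].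
    - destruct (step (S N) r _ H1 H2) as [H3 H4].
      rewrite sum_n_succ. eexists. split; [|exact H4].
      replace (F - (sum_n (fun n => p n ^ 2 / w n) N + p (S N) ^ 2 / w (S N)))
        with (F - sum_n (fun n => p n ^ 2 / w n) N - p (S N) ^ 2 / w (S N)) by ring.
      exact H3. }
  intros N. destruct (main N) as [r [Hr _]].
  assert (H : 0 <= RInt (fun t => r t * r t) a b).
  { apply RInt_ge_0; [exact Hab| |intros x _; nra].
    eexists; exact Hr. }
  rewrite (is_RInt_unique _ _ _ _ Hr) in H. lra.
Qed.

Lemma sin_INR_diff_PI (m n : nat) : sin ((INR m - INR n) * PI) = 0.
Proof.
  apply sin_eq_0_1. exists (Z.of_nat m - Z.of_nat n)%Z.
  now rewrite minus_IZR, <- !INR_IZR_INZ.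
Qed.

Lemma cos_half_odd_PI (n : nat) : cos ((INR (S n) - 1 / 2) * PI) = 0.
Proof.
  apply cos_eq_0_1. exists (Z.of_nat n).
  rewrite <- INR_IZR_INZ, S_INR. field.
Qed.

Lemma is_RInt_ftc (f df : R -> R) (a b v : R) :
  (forall x, is_derive f x (df x)) -> (forall x, continuous df x) ->
  f b - f a = v -> is_RInt df a b v.
Proof.
  intros Hd Hc <-.
  apply (is_RInt_derive f df a b); intros x _; [apply Hd|apply Hc].
Qed.

(* The antiderivative of [exp (a t) (b cos (b t) + a sin (b t))] is
   [exp (a t) sin (b t)], so the Bessel coefficients of [exp (a t)] with respect
   to this family on [-PI, PI] all have modulus [exp (a PI) + exp (- a PI)]. *)
Lemma half_odd_sum_bound (a : R) (N : nat) : 0 < a ->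
  sum_n (fun n => 2 * a / (a ^ 2 + (INR (S n) - 1 / 2) ^ 2)) N <=
  PI * ((exp (a * PI) - exp (- (a * PI))) / (exp (a * PI) + exp (- (a * PI)))).
Proof.
  intros Ha.
  set (b := fun n => INR (S n) - 1 / 2).
  set (P := exp (a * PI)). set (M := exp (- (a * PI))).
  assert (HP : 0 < P) by apply exp_pos.
  assert (HM : 0 < M) by apply exp_pos.
  assert (Hpi := PI_RGT_0).
  assert (Hb : forall n, 0 < b n).
  { intros n. unfold b. rewrite S_INR. assert (H := pos_INR n). lra. }
  set (e := fun n t => b n * cos (b n * t) + a * sin (b n * t)).
  assert (Hsub : forall m n, sin ((b m - b n) * PI) = 0).
  { intros m n. replace (b m - b n) with (INR (S m) - INR (S n)) by (unfold b; ring).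
    apply sin_INR_diff_PI. }
  assert (Hadd : forall m n, sin ((b m + b n) * PI) = 0).
  { intros m n. replace (b m + b n) with (INR (S m + n) - INR 0).
    - apply sin_INR_diff_PI.
    - unfold b. rewrite plus_INR, !S_INR. simpl. lra. }
  assert (Hbess : sum_n (fun n => (sin (b n * PI) * (P + M)) ^ 2 /
                                  (PI * (a ^ 2 + b n ^ 2))) N
                  <= (P * P - M * M) / (2 * a)).
  { apply (bessel_inequality (- PI) PI _ (fun t => exp (a * t)) e
             (fun n => sin (b n * PI) * (P + M)) (fun n => PI * (a ^ 2 + b n ^ 2))).
    - lra.
    - apply (is_RInt_ftc (fun t => exp (a * t) * exp (a * t) / (2 * a))).
      + intros t. auto_derive; [trivial|]. field. lra.
      + intros t. apply @ex_derive_continuous; auto_derive; trivial.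
      + replace (a * - PI) with (- (a * PI)) by ring. fold P M. field. lra.
    - intros n. apply (is_RInt_ftc (fun t => exp (a * t) * sin (b n * t))).
      + intros t. auto_derive; [trivial|]. unfold e. ring.
      + intros t. unfold e. apply @ex_derive_continuous; auto_derive; trivial.
      + replace (a * - PI) with (- (a * PI)) by ring.
        replace (b n * - PI) with (- (b n * PI)) by ring.
        rewrite sin_neg. fold P M. ring.
    - intros m n Hmn.
      assert (Hne : b m - b n <> 0).
      { unfold b. intros H. apply Hmn. apply eq_add_S. apply INR_eq. lra. }
      assert (Hne' : b m + b n <> 0) by (assert (H1 := Hb m); assert (H2 := Hb n); lra).
      (* Antiderivative of [e m t * e n t] by the product-to-sum formulas. Between -PI and PI the
         sine terms vanish by [Hsub] and [Hadd], and the cosine terms cancel because they are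
         even. *)
      apply (is_RInt_ftc (fun t =>
        (b m * b n + a ^ 2) / 2 * (sin ((b m - b n) * t) / (b m - b n)) +
        (b m * b n - a ^ 2) / 2 * (sin ((b m + b n) * t) / (b m + b n)) -
        a / 2 * cos ((b m + b n) * t) + a / 2 * cos ((b m - b n) * t))).
      + intros t. auto_derive; [tauto|]. unfold e.
        rewrite !Rmult_minus_distr_r, !Rmult_plus_distr_r.
        rewrite sin_plus, sin_minus, cos_plus, cos_minus. field. tauto.
      + intros t. unfold e. apply @ex_derive_continuous; auto_derive; trivial.
      + rewrite <- !Ropp_mult_distr_r, !sin_neg, !cos_neg, Hsub, Hadd. field. tauto.
    - intros n. specialize (Hb n).
      apply (is_RInt_ftc (fun t => (a ^ 2 + b n ^ 2) / 2 * t +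
        (b n ^ 2 - a ^ 2) / (2 * b n) * (sin (b n * t) * cos (b n * t)) +
        a * sin (b n * t) ^ 2)).
      + intros t. auto_derive; [trivial|]. unfold e.
        assert (H : sin (b n * t) * sin (b n * t) = 1 - cos (b n * t) * cos (b n * t)).
        { assert (H := sin2_cos2 (b n * t)). unfold Rsqr in H. lra. }
        transitivity ((a ^ 2 + b n ^ 2) / 2 +
          (b n ^ 2 - a ^ 2) / 2 *
            (cos (b n * t) * cos (b n * t) - sin (b n * t) * sin (b n * t)) +
          2 * a * b n * sin (b n * t) * cos (b n * t)); [field; lra|].
        transitivity (b n ^ 2 * (cos (b n * t) * cos (b n * t)) +
          a ^ 2 * (sin (b n * t) * sin (b n * t)) +
          2 * a * b n * sin (b n * t) * cos (b n * t)); [rewrite H; field|ring].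
      + intros t. unfold e. apply @ex_derive_continuous; auto_derive; trivial.
      + rewrite <- !Ropp_mult_distr_r, !sin_neg, !cos_neg.
        assert (Hc : cos (b n * PI) = 0) by apply cos_half_odd_PI.
        rewrite Hc. field. lra.
    - intros n. apply Rmult_lt_0_compat; [exact Hpi|]. assert (H := Hb n). nra. }
  (* As [sin (b n * PI) ^ 2 = 1], every squared coefficient is (P + M)^2, and this factor turns the
     claim into [Hbess]. *)
  apply Rmult_le_reg_r with ((P + M) ^ 2 / (2 * a * PI)).
  { apply Rdiv_lt_0_compat; nra. }
  replace (PI * ((P - M) / (P + M)) * ((P + M) ^ 2 / (2 * a * PI)))
    with ((P * P - M * M) / (2 * a)) by (field; lra).
  eapply Rle_trans; [|exact Hbess]. apply Req_le.
  change (sum_n (fun n => 2 * a / (a ^ 2 + (INR (S n) - 1 / 2) ^ 2)) N)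
    with (sum_n (fun n => 2 * a / (a ^ 2 + b n ^ 2)) N).
  rewrite Rmult_comm.
  rewrite <- (sum_n_mult_l (K := R_Ring) ((P + M) ^ 2 / (2 * a * PI))).
  apply sum_n_ext. intros n.
  match goal with |- mult ?x ?y = ?z => change (x * y = z) end.
  assert (Hs : sin (b n * PI) ^ 2 = 1).
  { assert (H := sin2_cos2 (b n * PI)). unfold Rsqr in H.
    assert (Hc : cos (b n * PI) = 0) by apply cos_half_odd_PI. rewrite Hc in H. nra. }
  rewrite Rpow_mult_distr, Hs. specialize (Hb n). field. split; [nra|lra].
Qed.

(** * Estimates for differences of arctangents *)

Lemma atan_mvt (u v : R) : u <= v ->
  exists c, u <= c <= v /\ atan v - atan u = (v - u) / (1 + c ^ 2).
Proof.
  intros Huv.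
  destruct (MVT_gen atan u v (fun x => / (1 + x ^ 2))) as [c [Hc E]].
  - intros x _. apply is_derive_Reals. apply derivable_pt_lim_atan.
  - intros x _. apply derivable_continuous_pt. apply derivable_pt_atan.
  - rewrite Rmin_left, Rmax_right in Hc by exact Huv.
    exists c. split; [exact Hc|]. rewrite E. unfold Rdiv. ring.
Qed.

Lemma atan_sub_le (u v : R) : u <= v -> atan v - atan u <= v - u.
Proof.
  intros Huv. destruct (atan_mvt u v Huv) as [c [_ ->]].
  apply Rle_div_l; nra.
Qed.

Lemma atan_sub_ge (u v : R) : 0 <= u <= v ->
  (v - u) / (1 + v ^ 2) <= atan v - atan u.
Proof.
  intros [Hu Huv]. destruct (atan_mvt u v Huv) as [c [Hc ->]].
  apply Rmult_le_compat_l; [lra|]. apply Rinv_le_contravar; nra.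
Qed.

(** The right-hand side is tan (atan v - atan u). The difference of the two sides vanishes at
    [v = u], and its derivative in [v] is (v - u)^2 / ((1 + u v)^2 (1 + v^2)). *)
Lemma atan_sub_le_tan_sub (u v : R) : 0 <= u <= v ->
  atan v - atan u <= (v - u) / (1 + u * v).
Proof.
  intros [Hu Huv].
  set (f := fun t => (t - u) / (1 + u * t) - atan t).
  set (df := fun t => (1 + u ^ 2) / (1 + u * t) ^ 2 - / (1 + t ^ 2)).
  assert (Hd : forall t, u <= t -> is_derive f t (df t)).
  { intros t Ht. unfold f, df. apply @is_derive_minus.
    - auto_derive; [nra|]. field. nra.
    - apply is_derive_Reals. apply derivable_pt_lim_atan. }
  destruct (MVT_gen f u v df) as [c [Hc E]].
  - intros t Ht. rewrite Rmin_left in Ht by lra. apply Hd. lra.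
  - intros t Ht. rewrite Rmin_left in Ht by lra.
    apply continuity_pt_filterlim. apply @ex_derive_continuous. eexists. apply Hd. lra.
  - rewrite Rmin_left, Rmax_right in Hc by exact Huv.
    assert (Hdc : 0 <= df c).
    { unfold df.
      assert (H1 : 0 < 1 + u * c) by nra.
      replace ((1 + u ^ 2) / (1 + u * c) ^ 2 - / (1 + c ^ 2))
        with ((c - u) ^ 2 / ((1 + u * c) ^ 2 * (1 + c ^ 2))) by (field; nra).
      apply Rdiv_le_0_compat; [apply pow2_ge_0|].
      apply Rmult_lt_0_compat; [apply pow_lt; lra|nra]. }
    assert (H : 0 <= f v - f u) by (rewrite E; apply Rmult_le_pos; lra).
    unfold f in H. replace ((u - u) / (1 + u * u)) with 0 in H by (unfold Rdiv; ring).
    lra.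
Qed.

(** * Convergence of the series for [nu] and upper bounds *)

(** Index [n] stands for the summand of index n + 1, so that [nu theta z] is
    [Series (nu_term theta z)] by conversion. *)
Definition nu_term (theta z : R) (n : nat) : R :=
  2 * z / (1 + z ^ 2 * (INR (S n) - theta) ^ 2).

Lemma shift_pos (theta : R) (n : nat) : theta < 1 -> 0 < INR (S n) - theta.
Proof. intros H. rewrite S_INR. assert (Hn := pos_INR n). lra. Qed.

Lemma weight_pos (z x : R) : 0 < 1 + z ^ 2 * x ^ 2.
Proof. assert (0 <= z ^ 2 * x ^ 2) by (apply Rmult_le_pos; apply pow2_ge_0). lra. Qed.

Lemma nu_term_pos (theta z : R) (n : nat) : 0 < z -> 0 < nu_term theta z n.
Proof.
  intros Hz. unfold nu_term. apply Rdiv_lt_0_compat; [lra|apply weight_pos].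
Qed.

(** Integral comparison: summands decrease in the index, so each one after the first is at most an
    arctangent difference over the preceding unit interval; the first is at most [2 * z]. *)
Lemma nu_term_sum_le (theta z : R) (N : nat) : theta < 1 -> 0 < z ->
  sum_n (nu_term theta z) N <= PI + 2 * z.
Proof.
  intros Ht Hz.
  assert (H : sum_n (nu_term theta z) N <=
    2 * z + 2 * atan (z * (INR (S N) - theta)) - 2 * atan (z * (1 - theta))).
  { induction N as [|N IH].
    - rewrite sum_n_zero. unfold nu_term. change (INR 1) with 1.
      assert (2 * z / (1 + z ^ 2 * (1 - theta) ^ 2) <= 2 * z); [|lra].
      apply Rle_div_l; [apply weight_pos|]. assert (H := weight_pos z (1 - theta)).
      assert (0 <= z ^ 2 * (1 - theta) ^ 2) by (apply Rmult_le_pos; apply pow2_ge_0).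
      nra.
    - rewrite sum_n_succ.
      assert (Hx := shift_pos theta N Ht).
      assert (Hs := atan_sub_ge (z * (INR (S N) - theta)) (z * (INR (S (S N)) - theta))).
      unfold nu_term at 2. rewrite (S_INR (S N)) in *.
      assert (E : 2 * z / (1 + z ^ 2 * (INR (S N) + 1 - theta) ^ 2) =
        2 * ((z * (INR (S N) + 1 - theta) - z * (INR (S N) - theta)) /
             (1 + (z * (INR (S N) + 1 - theta)) ^ 2))).
      { rewrite Rpow_mult_distr. unfold Rdiv. ring. }
      rewrite E.
      assert (0 <= z * (INR (S N) - theta) <= z * (INR (S N) + 1 - theta)) by nra.
      specialize (Hs H). lra. }
  assert (H1 := atan_bound (z * (INR (S N) - theta))).
  assert (H2 : 0 < atan (z * (1 - theta))).
  { rewrite <- atan_0. apply atan_increasing. nra. }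
  lra.
Qed.

Lemma ex_series_nu_term (theta z : R) : theta < 1 -> 0 < z -> ex_series (nu_term theta z).
Proof.
  intros Ht Hz. apply (ex_series_of_bounded _ (PI + 2 * z)).
  - intros n. apply Rlt_le. now apply nu_term_pos.
  - intros N. now apply nu_term_sum_le.
Qed.

Lemma nu_le (theta z : R) : theta < 1 -> 0 < z -> nu theta z <= PI + 2 * z.
Proof.
  intros Ht Hz. apply (ex_series_of_bounded (nu_term theta z) (PI + 2 * z)).
  - intros n. apply Rlt_le. now apply nu_term_pos.
  - intros N. now apply nu_term_sum_le.
Qed.

Lemma nu_pos (theta z : R) : theta < 1 -> 0 < z -> 0 < nu theta z.
Proof.
  intros Ht Hz. apply Rlt_le_trans with (nu_term theta z 0).
  - now apply nu_term_pos.
  - apply (term_le_Series (nu_term theta z)).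
    + intros n. apply Rlt_le. now apply nu_term_pos.
    + now apply ex_series_nu_term.
Qed.

(** Each term increases with theta up to 1/2, where [half_odd_sum_bound] applies with [a = / z].
    Strictness survives the limit because the bound [PI * q] does not depend on [N]. *)
Lemma nu_lt_PI (theta z : R) : theta <= 1 / 2 -> 0 < z -> nu theta z < PI.
Proof.
  intros Ht Hz.
  set (q := (exp (/ z * PI) - exp (- (/ z * PI))) / (exp (/ z * PI) + exp (- (/ z * PI)))).
  assert (Hq : q < 1).
  { unfold q. assert (H1 := exp_pos (/ z * PI)). assert (H2 := exp_pos (- (/ z * PI))).
    apply Rlt_div_l; lra. }
  apply Rle_lt_trans with (PI * q).
  2:{ assert (H := PI_RGT_0). nra. }
  apply (ex_series_of_bounded (nu_term theta z) (PI * q)).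
  - intros n. apply Rlt_le. now apply nu_term_pos.
  - intros N. eapply Rle_trans.
    2:{ apply (half_odd_sum_bound (/ z) N). now apply Rinv_0_lt_compat. }
    apply sum_n_m_le. intros n. unfold nu_term.
    assert (Hh : 0 < INR (S n) - 1 / 2) by (apply shift_pos; lra).
    replace (2 * / z / ((/ z) ^ 2 + (INR (S n) - 1 / 2) ^ 2))
      with (2 * z / (1 + z ^ 2 * (INR (S n) - 1 / 2) ^ 2)).
    2:{ field. assert (H := weight_pos z (INR (S n) - 1 / 2)). split; [nra|lra]. }
    apply Rmult_le_compat_l; [lra|].
    apply Rinv_le_contravar; [apply weight_pos|].
    apply Rplus_le_compat_l. apply Rmult_le_compat_l; [apply pow2_ge_0|].
    apply pow_incr. lra.
Qed.

(** * Lower bounds for [nu] by telescoping arctangents *)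

(** The left sides of the termwise hypothesis telescope, and atan tends to PI / 2. The shift [c]
    places the comparison interval around n - theta, and [l] is a defect of total at most [L]. *)
Lemma nu_ge_telescope (theta z c L : R) (l : nat -> R) : theta < 1 -> 0 < z -> 0 <= c ->
  (forall n, 2 * (atan (z * (INR (S n) - theta + c)) - atan (z * (INR n - theta + c)))
             <= nu_term theta z n + l n) ->
  (forall N, sum_n l N <= L) ->
  PI - 2 * atan (z * (c - theta)) - L <= nu theta z.
Proof.
  intros Ht Hz Hc Hterm HL.
  assert (Hsum : forall N, 2 * atan (z * (INR (S N) - theta + c)) - 2 * atan (z * (c - theta))
                           <= sum_n (nu_term theta z) N + sum_n l N).
  { induction N as [|N IH].
    - rewrite !sum_n_zero. assert (H := Hterm 0%nat). simpl (INR 0) in H.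
      replace (0 - theta + c) with (c - theta) in H by ring. lra.
    - rewrite !sum_n_succ. assert (H := Hterm (S N)). lra. }
  apply Rnot_lt_le. intros Hlt.
  set (d := PI - 2 * atan (z * (c - theta)) - L - nu theta z).
  assert (Hd : 0 < d) by (unfold d; lra).
  (* Such an [N] gives [y > 2 / d], so the missing tail PI - 2 atan y, at most 2 / y, is below the
     supposed gap [d]. *)
  destruct (INR_unbounded (2 / (d * z))) as [N HN].
  set (y := z * (INR (S N) - theta + c)).
  assert (Hy : 2 < d * y).
  { apply Rlt_div_l in HN; [|nra]. unfold y. rewrite S_INR.
    assert (0 < d * z) by nra. nra. }
  assert (Hy0 : 0 < y) by nra.
  assert (Hat : PI / 2 - / y <= atan y).
  { assert (H := atan_inv y Hy0). assert (Hi := Rinv_0_lt_compat y Hy0).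
    assert (H' := atan_sub_le 0 (/ y)). rewrite atan_0 in H'. lra. }
  assert (Hi : 2 * / y < d).
  { apply (Rlt_div_l 2 d y Hy0). exact Hy. }
  assert (Hpart : sum_n (nu_term theta z) N <= nu theta z).
  { apply (sum_n_le_Series (nu_term theta z)).
    - intros n. apply Rlt_le. now apply nu_term_pos.
    - now apply ex_series_nu_term. }
  specialize (Hsum N). specialize (HL N). fold y in Hsum. unfold d in *. lra.
Qed.

(** Telescoping with [c = 1] and no defect: the tangent bound on [x, x + 1] has denominator 1 + z^2
    x (x + 1), at least 1 + z^2 x^2. *)
Lemma nu_ge_PI_sub (theta z : R) : theta < 1 -> 0 < z ->
  PI - 2 * (z * (1 - theta)) <= nu theta z.
Proof.
  intros Ht Hz.
  assert (H : PI - 2 * atan (z * (1 - theta)) - 0 <= nu theta z).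
  { apply nu_ge_telescope with (l := fun _ => 0); try lra.
    - intros n. unfold nu_term.
      assert (Hx := shift_pos theta n Ht). rewrite Rplus_0_r.
      replace (INR n - theta + 1) with (INR (S n) - theta) by (rewrite S_INR; ring).
      set (x := INR (S n) - theta) in *.
      assert (Hs := atan_sub_le_tan_sub (z * x) (z * (x + 1))).
      replace (2 * z / (1 + z ^ 2 * x ^ 2)) with (2 * (z / (1 + z ^ 2 * x ^ 2)))
        by (unfold Rdiv; ring).
      apply Rmult_le_compat_l; [lra|]. eapply Rle_trans; [apply Hs; nra|].
      replace (z * (x + 1) - z * x) with z by ring.
      apply Rmult_le_compat_l; [lra|]. apply Rinv_le_contravar; [apply weight_pos|].
      assert (0 < z * z * x) by (repeat apply Rmult_lt_0_compat; lra). nra.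
    - intros N. rewrite sum_n_const. rewrite Rmult_0_r. lra. }
  assert (H' := atan_sub_le 0 (z * (1 - theta))). rewrite atan_0 in H'.
  assert (0 <= z * (1 - theta)) by nra. lra.
Qed.

Lemma sum_n_indicator_le (K : nat) (v : R) (N : nat) : 0 <= v ->
  sum_n (fun n => if (n <? K)%nat then v else 0) N <= INR K * v.
Proof.
  intros Hv.
  assert (H : sum_n (fun n => if (n <? K)%nat then v else 0) N <= INR (Nat.min (S N) K) * v).
  { induction N as [|N IH].
    - rewrite sum_n_zero. destruct K as [|K]; simpl; lra.
    - rewrite sum_n_succ. destruct (Nat.ltb_spec (S N) K) as [Hlt|Hge].
      + rewrite Nat.min_l in * by lia. rewrite S_INR. lra.
      + replace (Nat.min (S (S N)) K) with (Nat.min (S N) K) by lia. lra. }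
  eapply Rle_trans; [exact H|]. apply Rmult_le_compat_r; [exact Hv|].
  apply le_INR. lia.
Qed.

(* With [c] strictly between [1 / 2] and [theta], the telescoping
   [2 atan (z (x + c)) - 2 atan (z (x + c - 1))] stays below the term at
   [x = n - theta] except for boundedly many [n]; there the defect is [O(z^3)],
   which the gain [2 atan (z (theta - c))], linear in [z], absorbs. *)
Lemma nu_gt_PI (theta : R) : 1 / 2 < theta < 1 ->
  exists z, 0 < z <= 1 /\ PI < nu theta z.
Proof.
  intros [Ht1 Ht2].
  set (c := (theta + 1 / 2) / 2).
  assert (Hc : 1 / 2 < c < theta) by (unfold c; lra).
  (* For x > K one has (2 c - 1) x > 1 >= c (1 - c), which is x^2 <= (x + c - 1) (x + c), so no
     defect occurs there. *)
  destruct (INR_unbounded (1 / (2 * c - 1))) as [K HK].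
  apply Rlt_div_l in HK; [|lra].
  set (k := INR K) in *.
  assert (Hk : 1 < k) by nra.
  assert (Hk2 : 0 < k ^ 2) by (apply pow_lt; lra).
  assert (Hk3 : 0 < k ^ 3) by (apply pow_lt; lra).
  (* Chosen so that the gain z (theta - c) = z^2 (4 k^3 + 1) exceeds the total defect 2 z^3 k^3. *)
  set (z := (theta - c) / (4 * k ^ 3 + 1)).
  assert (Hz : 0 < z) by (apply Rdiv_lt_0_compat; lra).
  assert (Ez : z * (4 * k ^ 3 + 1) = theta - c) by (unfold z; field; lra).
  assert (Hz1 : z < 1) by nra.
  exists z. split; [lra|].
  (* For x <= k the term falls short of 2 z by at most 2 z^3 x^2, hence by at most [v]. *)
  set (v := 2 * z ^ 3 * k ^ 2).
  assert (Hz3 : 0 < z ^ 3) by (apply pow_lt; lra).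
  assert (Hv : 0 < v) by (unfold v; apply Rmult_lt_0_compat; lra).
  assert (H : PI - 2 * atan (z * (c - theta)) - k * v <= nu theta z).
  { apply nu_ge_telescope with (l := fun n => if (n <? K)%nat then v else 0); try lra.
    2:{ intros N. apply sum_n_indicator_le. lra. }
    intros n. unfold nu_term.
    assert (Hx := shift_pos theta n Ht2).
    replace (INR n - theta + c) with (INR (S n) - theta + (c - 1)) by (rewrite S_INR; ring).
    destruct (Nat.ltb_spec n K) as [Hlt|Hge].
    - assert (HxK : INR (S n) <= k) by (apply le_INR; lia).
      set (x := INR (S n) - theta) in *.
      assert (Hl := atan_sub_le (z * (x + (c - 1))) (z * (x + c))).
      assert (Hx2 : x ^ 2 <= k ^ 2) by (apply pow_incr; unfold x in *; lra).
      assert (Hlow : 2 * z - v <= 2 * z / (1 + z ^ 2 * x ^ 2)).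
      { apply Rle_div_r; [apply weight_pos|].
        assert (Hx20 : 0 <= x ^ 2) by apply pow2_ge_0.
        assert (E1 : z ^ 3 * x ^ 2 <= z ^ 3 * k ^ 2) by (apply Rmult_le_compat_l; lra).
        assert (E2 : 0 <= v * (z ^ 2 * x ^ 2)).
        { apply Rmult_le_pos; [lra|]. apply Rmult_le_pos; [apply pow2_ge_0|lra]. }
        unfold v in *. nra. }
      nra.
    - rewrite Rplus_0_r.
      assert (HnK : k <= INR n) by (apply le_INR; lia).
      rewrite S_INR in *. set (x := INR n + 1 - theta) in *.
      assert (Hxk : k < x) by (unfold x; lra).
      assert (Hs := atan_sub_le_tan_sub (z * (x + (c - 1))) (z * (x + c))).
      replace (2 * z / (1 + z ^ 2 * x ^ 2)) with (2 * (z / (1 + z ^ 2 * x ^ 2)))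
        by (unfold Rdiv; ring).
      apply Rmult_le_compat_l; [lra|]. eapply Rle_trans; [apply Hs; nra|].
      replace (z * (x + c) - z * (x + (c - 1))) with z by ring.
      apply Rmult_le_compat_l; [lra|]. apply Rinv_le_contravar; [apply weight_pos|].
      assert (Hp : x ^ 2 <= (x + (c - 1)) * (x + c)) by nra.
      assert (Hz2 : 0 <= z ^ 2) by apply pow2_ge_0.
      assert (Hm := Rmult_le_compat_l _ _ _ Hz2 Hp). nra. }
  set (y := z * (theta - c)).
  replace (z * (c - theta)) with (- y) in H by (unfold y; ring).
  rewrite atan_opp in H.
  assert (Hy : 0 < y < 1) by (unfold y; split; nra).
  assert (Hat : y / 2 <= atan y).
  { assert (H' := atan_sub_ge 0 y). rewrite atan_0 in H'.
    assert (H'' : y / 2 <= (y - 0) / (1 + y ^ 2)).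
    { rewrite Rminus_0_r. apply Rmult_le_compat_l; [lra|].
      apply Rinv_le_contravar; nra. }
    lra. }
  assert (Hgain : k * v < y).
  { unfold v, y. rewrite <- Ez.
    replace (k * (2 * z ^ 3 * k ^ 2)) with (z * (z * (z * (2 * k ^ 3)))) by ring.
    apply Rmult_lt_compat_l; [lra|]. apply Rmult_lt_compat_l; [lra|]. nra. }
  lra.
Qed.

(** * The right endpoint, continuity of [nu] and attainment of the maximum *)

(* At [z = 1 / (1 - theta)] the first term is stationary and every other one is
   strictly decreasing in [z]. *)
Lemma nu_endpoint_lt (theta : R) : 0 <= theta < 1 ->
  exists z, 0 < z < 1 / (1 - theta) /\ nu theta (1 / (1 - theta)) < nu theta z.
Proof.
  intros [Ht0 Ht].
  set (s := 1 - theta). assert (Hs : 0 < s <= 1) by (unfold s; lra).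
  set (r := (1 + s) / s).
  assert (Hr : 2 <= r) by (apply Rle_div_r; lra).
  (* In units of 2 / s, moving from 1 / s to (1 - eps) / s costs the first term at most eps^2 / 2,
     while this choice makes the second gain at least eps^2. *)
  set (eps := / (1 + r ^ 2) ^ 2).
  assert (HD : 5 <= 1 + r ^ 2) by nra.
  assert (HD2 : 25 <= (1 + r ^ 2) ^ 2) by nra.
  assert (Heps : 0 < eps) by (apply Rinv_0_lt_compat; lra).
  assert (Heps2 : eps <= 1 / 2).
  { unfold eps. replace (1 / 2) with (/ 2) by lra. apply Rinv_le_contravar; lra. }
  set (t := 1 - eps). assert (Htt : 1 / 2 <= t < 1) by (unfold t; lra).
  assert (Hz0 : 0 < 1 / s) by (apply Rdiv_lt_0_compat; lra).
  assert (Hz : 0 < t / s) by (apply Rdiv_lt_0_compat; lra).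
  exists (t / s). split.
  { split; [exact Hz|]. apply Rmult_lt_compat_r; [apply Rinv_0_lt_compat|]; lra. }
  assert (Hsplit : forall z, 0 < z -> nu theta z =
    nu_term theta z 0 + (nu_term theta z 1 + Series (fun n => nu_term theta z (S (S n))))).
  { intros z Hzp. assert (Hex := ex_series_nu_term theta z Ht Hzp).
    change (nu theta z) with (Series (nu_term theta z)).
    rewrite Series_incr_1 by exact Hex.
    rewrite (Series_incr_1 (fun k => nu_term theta z (S k))); [reflexivity|].
    now apply (ex_series_incr_1 (nu_term theta z)). }
  (* Rescaling z = q / s puts the endpoint at q = 1; the ratios (n + s) / s are 1, then [r], then at
     least 2. *)
  assert (Hterm : forall q n, nu_term theta (q / s) n =
    2 / s * (q / (1 + q ^ 2 * ((INR n + s) / s) ^ 2))).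
  { intros q n. unfold nu_term. rewrite S_INR.
    replace (INR n + 1 - theta) with (INR n + s) by (unfold s; ring).
    replace ((q / s) ^ 2 * (INR n + s) ^ 2) with (q ^ 2 * ((INR n + s) / s) ^ 2)
      by (field; lra).
    unfold Rdiv. ring. }
  rewrite !Hsplit by assumption.
  assert (Htail : Series (fun n => nu_term theta (1 / s) (S (S n))) <=
                  Series (fun n => nu_term theta (t / s) (S (S n)))).
  { apply Series_le.
    2:{ apply (ex_series_incr_n (nu_term theta (t / s)) 2). now apply ex_series_nu_term. }
    intros n. split; [apply Rlt_le; now apply nu_term_pos|].
    rewrite !Hterm. apply Rmult_le_compat_l.
    { apply Rlt_le, Rdiv_lt_0_compat; lra. }
    assert (Hrho : 2 <= (INR (S (S n)) + s) / s).
    { apply Rle_div_r; [lra|]. rewrite !S_INR. assert (Hn := pos_INR n). lra. }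
    set (rho := (INR (S (S n)) + s) / s) in *.
    assert (W1 := weight_pos t rho). assert (W2 := weight_pos 1 rho).
    apply Rle_div_l; [exact W2|].
    replace (t / (1 + t ^ 2 * rho ^ 2) * (1 + 1 ^ 2 * rho ^ 2))
      with (t * (1 + rho ^ 2) / (1 + t ^ 2 * rho ^ 2)) by (field; lra).
    apply Rle_div_r; [exact W1|].
    assert (0 <= (1 - t) * (t * rho ^ 2 - 1)) by (apply Rmult_le_pos; nra). nra. }
  assert (Hhead : / 2 + / (1 + r ^ 2) < t / (1 + t ^ 2) + t / (1 + t ^ 2 * r ^ 2)).
  { assert (H1 : / 2 - eps ^ 2 / 2 <= t / (1 + t ^ 2)).
    { replace (t / (1 + t ^ 2)) with (/ 2 - eps ^ 2 / (2 * (1 + t ^ 2))).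
      2:{ replace eps with (1 - t) by (unfold t; ring). field. nra. }
      assert (eps ^ 2 / (2 * (1 + t ^ 2)) <= eps ^ 2 / 2); [|lra].
      apply Rmult_le_compat_l; [apply pow2_ge_0|]. apply Rinv_le_contravar; nra. }
    assert (H2 : / (1 + r ^ 2) + eps ^ 2 <= t / (1 + t ^ 2 * r ^ 2)).
    { assert (W := weight_pos t r).
      replace (t / (1 + t ^ 2 * r ^ 2)) with (/ (1 + r ^ 2) +
        eps * ((t * r ^ 2 - 1) / ((1 + t ^ 2 * r ^ 2) * (1 + r ^ 2)))).
      2:{ replace eps with (1 - t) by (unfold t; ring). field. lra. }
      apply Rplus_le_compat_l. replace (eps ^ 2) with (eps * eps) by ring.
      apply Rmult_le_compat_l; [lra|]. unfold eps.
      rewrite <- (Rmult_1_l (/ (1 + r ^ 2) ^ 2)).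
      apply Rmult_le_compat; [lra|apply Rlt_le; exact Heps|nra|].
      apply Rinv_le_contravar; [nra|]. replace ((1 + r ^ 2) ^ 2) with ((1 + r ^ 2) * (1 + r ^ 2)) by ring.
      apply Rmult_le_compat_r; [lra|].
      assert (t ^ 2 * r ^ 2 <= 1 * r ^ 2) by (apply Rmult_le_compat_r; nra). lra. }
    assert (0 < eps ^ 2) by (apply pow_lt; lra). lra. }
  rewrite !Hterm. change (INR 0) with 0. change (INR 1) with 1. fold r.
  replace ((0 + s) / s) with 1 by (field; lra). rewrite !pow1, !Rmult_1_r, !Rmult_1_l.
  assert (Hm := Rmult_lt_compat_l (2 / s) _ _
                  (Rdiv_lt_0_compat 2 s Rlt_0_2 (proj1 Hs)) Hhead).
  replace (1 / (1 + 1)) with (/ 2) by lra.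
  replace (1 / (1 + r ^ 2)) with (/ (1 + r ^ 2)) by (unfold Rdiv; ring). lra.
Qed.

(** Termwise, with X = (n - theta)^2, the difference is 2 (z - w) (1 - z w X) / ((1 + z^2 X) (1 +
    w^2 X)). Since d^2 <= z w and (1 + z w X)^2 is at most that denominator, the term at [d]
    dominates it up to the factor |z - w| / d, and these terms are summable. *)
Lemma nu_lipschitz (theta d z w : R) : theta < 1 -> 0 < d -> d <= z -> d <= w ->
  nu theta z <= nu theta w + Rabs (z - w) / d * nu theta d.
Proof.
  intros Ht Hd Hz Hw.
  set (k := Rabs (z - w) / d).
  assert (Hk : 0 <= k) by (apply Rdiv_le_0_compat; [apply Rabs_pos|lra]).
  assert (Ew := ex_series_nu_term theta w Ht ltac:(lra)).
  assert (Ed := ex_series_nu_term theta d Ht ltac:(lra)).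
  assert (Ek : ex_series (fun n => k * nu_term theta d n))
    by (apply (ex_series_scal (V := R_NormedModule) k); exact Ed).
  change (Series (nu_term theta z) <= Series (nu_term theta w) + k * Series (nu_term theta d)).
  rewrite <- Series_scal_l, <- Series_plus by assumption.
  apply Series_le.
  2:{ now apply (ex_series_plus (V := R_NormedModule)). }
  intros n. split; [apply Rlt_le, nu_term_pos; lra|].
  unfold nu_term, k. set (x := INR (S n) - theta).
  set (X := x ^ 2). assert (HX : 0 <= X) by apply pow2_ge_0.
  assert (P : forall y, 0 < 1 + y ^ 2 * X) by (intros y; apply weight_pos).
  assert (Pz := P z). assert (Pw := P w). assert (Pd := P d).
  assert (Hzw : d ^ 2 * X <= z * w * X) by (apply Rmult_le_compat_r; nra).
  assert (HzwX : 0 <= z * w * X) by (apply Rmult_le_pos; nra).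
  assert (Hcs : (1 + z * w * X) * (1 + z * w * X) <= (1 + z ^ 2 * X) * (1 + w ^ 2 * X)).
  { assert (0 <= X * (z - w) ^ 2) by (apply Rmult_le_pos; [lra|apply pow2_ge_0]). nra. }
  assert (Hkey : Rabs (1 - z * w * X) * (1 + d ^ 2 * X) <= (1 + z ^ 2 * X) * (1 + w ^ 2 * X)).
  { eapply Rle_trans; [|exact Hcs]. apply Rmult_le_compat; try lra.
    - apply Rabs_pos.
    - apply Rabs_le. lra. }
  assert (Hdiff : 2 * z / (1 + z ^ 2 * X) - 2 * w / (1 + w ^ 2 * X) =
    2 * ((z - w) * (1 - z * w * X)) / ((1 + z ^ 2 * X) * (1 + w ^ 2 * X)))
    by (field; lra).
  assert (Habs : (z - w) * (1 - z * w * X) <= Rabs (z - w) * Rabs (1 - z * w * X)).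
  { rewrite <- Rabs_mult. apply Rle_abs. }
  assert (Hprod : 0 < (1 + z ^ 2 * X) * (1 + w ^ 2 * X)) by now apply Rmult_lt_0_compat.
  assert (Hbd : 2 * ((z - w) * (1 - z * w * X)) / ((1 + z ^ 2 * X) * (1 + w ^ 2 * X))
                <= Rabs (z - w) / d * (2 * d / (1 + d ^ 2 * X))).
  { apply Rle_div_l; [exact Hprod|].
    replace (Rabs (z - w) / d * (2 * d / (1 + d ^ 2 * X)) *
             ((1 + z ^ 2 * X) * (1 + w ^ 2 * X)))
      with (2 * Rabs (z - w) * ((1 + z ^ 2 * X) * (1 + w ^ 2 * X)) / (1 + d ^ 2 * X))
      by (field; lra).
    apply (proj1 (Rle_div_r _ _ _ Pd)).
    assert (Ha := Rabs_pos (z - w)).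
    assert (H1 := Rmult_le_compat_l _ _ _ Ha Hkey).
    assert (H2 : (z - w) * (1 - z * w * X) * (1 + d ^ 2 * X) <=
                 Rabs (z - w) * Rabs (1 - z * w * X) * (1 + d ^ 2 * X))
      by (apply Rmult_le_compat_r; lra).
    lra. }
  lra.
Qed.

Lemma continuity_pt_nu (theta z : R) : theta < 1 -> 0 < z -> continuity_pt (nu theta) z.
Proof.
  intros Ht Hz. set (d := z / 2). assert (Hd : 0 < d) by (unfold d; lra).
  assert (Hnu := nu_pos theta d Ht Hd).
  intros eps Heps. simpl. unfold R_dist.
  exists (Rmin d (eps * d / (nu theta d))). split.
  { apply Rmin_pos; [exact Hd|]. apply Rdiv_lt_0_compat; [nra|lra]. }
  intros w [_ Hw].
  assert (Hw1 := Rlt_le_trans _ _ _ Hw (Rmin_l _ _)).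
  assert (Hw2 := Rlt_le_trans _ _ _ Hw (Rmin_r _ _)).
  assert (Hdw : d <= w).
  { apply Rabs_def2 in Hw1. unfold d in *. lra. }
  assert (Hdz : d <= z) by (unfold d; lra).
  assert (H1 := nu_lipschitz theta d z w Ht Hd Hdz Hdw).
  assert (H2 := nu_lipschitz theta d w z Ht Hd Hdw Hdz).
  rewrite (Rabs_minus_sym z w) in H1.
  assert (H3 : Rabs (w - z) / d * nu theta d < eps).
  { apply Rlt_div_r in Hw2; [|lra].
    replace (Rabs (w - z) / d * nu theta d) with (Rabs (w - z) * nu theta d / d)
      by (field; lra).
    apply Rlt_div_l; lra. }
  apply Rabs_def1; lra.
Qed.

(** On (0, d] the bound PI + 2 z stays below [nu theta z1], so the extreme value theorem on the
    compact interval from [d] to the endpoint suffices; [nu_endpoint_lt] then makes the maximum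
    interior. *)
Lemma nu_max_exists (theta z1 : R) : 0 <= theta < 1 ->
  0 < z1 <= 1 / (1 - theta) -> PI < nu theta z1 ->
  exists Z, 0 < Z < 1 / (1 - theta) /\
    forall z, 0 < z <= 1 / (1 - theta) -> nu theta z <= nu theta Z.
Proof.
  intros Ht Hz1 Hgt.
  set (d := (nu theta z1 - PI) / 4). assert (Hd : 0 < d) by (unfold d; lra).
  assert (Hsmall : forall z, 0 < z <= d -> nu theta z < nu theta z1).
  { intros z Hz. assert (H := nu_le theta z (proj2 Ht) (proj1 Hz)). unfold d in *. lra. }
  assert (Hdz1 : d < z1).
  { apply Rnot_le_lt. intros Hle. assert (H := Hsmall z1 (conj (proj1 Hz1) Hle)). lra. }
  destruct (continuity_ab_maj (nu theta) d (1 / (1 - theta))) as [Z [Hmax HZ]].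
  { lra. }
  { intros c Hc. apply continuity_pt_nu; lra. }
  assert (Hall : forall z, 0 < z <= 1 / (1 - theta) -> nu theta z <= nu theta Z).
  { intros z Hz. destruct (Rle_lt_dec z d) as [Hle|Hlt].
    - apply Rle_trans with (nu theta z1).
      + apply Rlt_le, Hsmall. lra.
      + apply Hmax. lra.
    - apply Hmax. lra. }
  exists Z. split; [|exact Hall].
  split; [lra|]. destruct (proj2 HZ) as [Hlt|Heq]; [exact Hlt|].
  destruct (nu_endpoint_lt theta Ht) as [w [Hw Hlt]].
  rewrite <- Heq in Hlt. specialize (Hall w ltac:(lra)). lra.
Qed.

(** * Sequences of class [D1] and the family [phi] *)

Lemma D1_ex_series_sq (a : nat -> R) : D1 a -> ex_series (fun k => a (S k) ^ 2).
Proof.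
  intros (_ & _ & H). apply (ex_series_le (V := R_CompleteNormedModule) _ _) with (2 := H).
  intros n. change (Rabs (a (S n) ^ 2) <= INR (S n) ^ 2 * a (S n) ^ 2).
  rewrite Rabs_right by (apply Rle_ge, pow2_ge_0).
  assert (Hn : 1 <= INR (S n)) by (rewrite S_INR; assert (H' := pos_INR n); lra).
  rewrite <- (Rmult_1_l (a (S n) ^ 2)) at 1.
  apply Rmult_le_compat_r; [apply pow2_ge_0|nra].
Qed.

Lemma D1_ex_series_shift (theta : R) (a : nat -> R) : 0 <= theta < 1 -> D1 a ->
  ex_series (fun k => (INR (S k) - theta) ^ 2 * a (S k) ^ 2).
Proof.
  intros Ht (_ & _ & H). apply (ex_series_le (V := R_CompleteNormedModule) _ _) with (2 := H).
  intros n.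
  change (Rabs ((INR (S n) - theta) ^ 2 * a (S n) ^ 2) <= INR (S n) ^ 2 * a (S n) ^ 2).
  assert (Hx := shift_pos theta n (proj2 Ht)).
  rewrite Rabs_right by (apply Rle_ge, Rmult_le_pos; apply pow2_ge_0).
  apply Rmult_le_compat_r; [apply pow2_ge_0|]. apply pow_incr. lra.
Qed.

Lemma D1_sq_pos (a : nat -> R) : D1 a -> 0 < sum1 (fun n => a n ^ 2).
Proof.
  intros Ha. apply Rnot_le_lt. intros Hle.
  assert (Hex := D1_ex_series_sq a Ha). destruct Ha as (_ & Hsum & _).
  assert (H0 : forall k, a (S k) = 0).
  { intros k.
    assert (H := term_le_Series (fun k => a (S k) ^ 2) k (fun _ => pow2_ge_0 _) Hex).
    unfold sum1 in Hle. simpl in H, Hle. nra. }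
  assert (H1 := is_series_unique _ _ Hsum).
  rewrite (Series_ext _ (fun _ => 0 * 0)) in H1 by (intros k; rewrite H0; ring).
  rewrite Series_scal_l in H1. lra.
Qed.

Lemma phi_eq (theta z : R) (n : nat) : theta < 1 -> 0 < z ->
  phi theta z (S n) = / nu theta z * nu_term theta z n.
Proof.
  intros Ht Hz. unfold phi, nu_term, Rdiv. ring.
Qed.

Lemma D1_phi (theta z : R) : 0 <= theta < 1 -> 0 < z -> D1 (phi theta z).
Proof.
  intros Ht Hz. assert (Hnu := nu_pos theta z (proj2 Ht) Hz).
  assert (Hi := Rinv_0_lt_compat _ Hnu).
  assert (Hex := ex_series_nu_term theta z (proj2 Ht) Hz).
  split; [|split].
  - intros [|n] Hn; [lia|]. rewrite phi_eq by lra.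
    assert (H := nu_term_pos theta z n Hz). nra.
  - replace 1 with (scal (/ nu theta z) (nu theta z)).
    2:{ change (/ nu theta z * nu theta z = 1). field. lra. }
    eapply is_series_ext; [intros n; symmetry; apply phi_eq; lra|].
    apply (is_series_scal_l (V := R_NormedModule) (/ nu theta z)).
    exact (Series_correct _ Hex).
  (* As n (1 - theta) <= n - theta, the product of n^2 and one factor [nu_term] is bounded; the
     other factor is summable. *)
  - set (C := (2 * z / (1 - theta) ^ 2 / z ^ 2 * (/ nu theta z) ^ 2)).
    apply (ex_series_le (V := R_CompleteNormedModule) _ (fun n => C * nu_term theta z n)).
    2:{ apply (ex_series_scal (V := R_NormedModule) C). exact Hex. }
    intros n. rewrite phi_eq by lra.
    change (Rabs (INR (S n) ^ 2 * (/ nu theta z * nu_term theta z n) ^ 2)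
            <= C * nu_term theta z n).
    rewrite Rabs_right by (apply Rle_ge, Rmult_le_pos; apply pow2_ge_0).
    unfold C. rewrite Rpow_mult_distr.
    assert (Hi2 : 0 < (/ nu theta z) ^ 2) by (apply pow_lt; lra).
    assert (Ht2 : 0 < (1 - theta) ^ 2) by (apply pow_lt; lra).
    assert (Hz2 : 0 < z ^ 2) by (apply pow_lt; lra).
    assert (Hterm := nu_term_pos theta z n Hz).
    replace (INR (S n) ^ 2 * ((/ nu theta z) ^ 2 * nu_term theta z n ^ 2))
      with (INR (S n) ^ 2 * nu_term theta z n * ((/ nu theta z) ^ 2 * nu_term theta z n)) by ring.
    rewrite (Rmult_assoc (2 * z / (1 - theta) ^ 2 / z ^ 2)).
    apply Rmult_le_compat_r; [nra|].
    unfold nu_term.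
    set (x := INR (S n) - theta).
    assert (W := weight_pos z x).
    assert (Hn : 1 <= INR (S n)) by (rewrite S_INR; assert (H' := pos_INR n); lra).
    assert (Hx : INR (S n) * (1 - theta) <= x) by (unfold x; nra).
    assert (Hx2 : (INR (S n) * (1 - theta)) ^ 2 <= x ^ 2)
      by (apply pow_incr; split; [apply Rmult_le_pos; lra|exact Hx]).
    rewrite Rpow_mult_distr in Hx2.
    replace (2 * z / (1 - theta) ^ 2 / z ^ 2) with (2 * z / ((1 - theta) ^ 2 * z ^ 2))
      by (field; lra).
    apply (proj1 (Rle_div_r _ _ _ (Rmult_lt_0_compat _ _ Ht2 Hz2))).
    replace (INR (S n) ^ 2 * (2 * z / (1 + z ^ 2 * x ^ 2)) * ((1 - theta) ^ 2 * z ^ 2))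
      with (2 * z * (INR (S n) ^ 2 * (1 - theta) ^ 2 * z ^ 2) / (1 + z ^ 2 * x ^ 2))
      by (field; lra).
    apply Rle_div_l; [exact W|]. apply Rmult_le_compat_l; [lra|]. nra.
Qed.

(** * The defect identity and the bounds for [J] *)

(* Completing the square in the weighted space: this is Cauchy-Schwarz together
   with its defect. *)
Lemma weighted_sq_distance (theta z : R) (a : nat -> R) : 0 <= theta < 1 -> 0 < z -> D1 a ->
  is_series (fun k => (1 + z ^ 2 * (INR (S k) - theta) ^ 2) *
                      (a (S k) - phi theta z (S k)) ^ 2)
    (sum1 (fun n => a n ^ 2) + z ^ 2 * sum1 (fun n => (INR n - theta) ^ 2 * a n ^ 2)
     - 2 * z / nu theta z).
Proof.
  intros Ht Hz Ha.
  assert (Hnu := nu_pos theta z (proj2 Ht) Hz).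
  assert (HA := Series_correct _ (D1_ex_series_sq a Ha)).
  assert (HB := Series_correct _ (D1_ex_series_shift theta a Ht Ha)).
  assert (Hf := Series_correct _ (ex_series_nu_term theta z (proj2 Ht) Hz)).
  destruct Ha as (_ & Hsum & _).
  (* The weight times [phi] is the constant 2 z / nu, so the cross term is a multiple of [a], summed
     by the normalisation, and the weight times [phi ^ 2] is a multiple of [nu_term]. *)
  assert (H := is_series_plus _ _ _ _ HA (is_series_plus _ _ _ _
    (is_series_scal_l (V := R_NormedModule) (z ^ 2) _ _ HB) (is_series_plus _ _ _ _
    (is_series_scal_l (V := R_NormedModule) (- (4 * z / nu theta z)) _ _ Hsum)
    (is_series_scal_l (V := R_NormedModule) (2 * z / nu theta z ^ 2) _ _ Hf)))).
  match type of H with is_series _ ?l =>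
    replace (sum1 _ + _ - _) with l end.
  2:{ unfold plus, scal; simpl plus; simpl scal.
      change (Series (nu_term theta z)) with (nu theta z).
      change (sum1 (fun n => a n ^ 2) + (z ^ 2 * sum1 (fun n => (INR n - theta) ^ 2 * a n ^ 2) +
        (- (4 * z / nu theta z) * 1 + 2 * z / nu theta z ^ 2 * nu theta z)) =
        sum1 (fun n => a n ^ 2) + z ^ 2 * sum1 (fun n => (INR n - theta) ^ 2 * a n ^ 2)
        - 2 * z / nu theta z).
      field. lra. }
  eapply is_series_ext; [|exact H].
  intros n.
  change (a (S n) ^ 2 + (z ^ 2 * ((INR (S n) - theta) ^ 2 * a (S n) ^ 2) +
    (- (4 * z / nu theta z) * a (S n) + 2 * z / nu theta z ^ 2 * nu_term theta z n)) =
    (1 + z ^ 2 * (INR (S n) - theta) ^ 2) * (a (S n) - phi theta z (S n)) ^ 2).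
  unfold phi, nu_term. assert (W := weight_pos z (INR (S n) - theta)). field. lra.
Qed.

(** For [a = phi theta z] the squared distance is 0, so A + z^2 B = 2 z / nu(z). Since [z] need not
    be the balancing scale of this sequence, AM-GM yields only an inequality. *)
Lemma J_phi_le (theta z : R) : 0 <= theta < 1 -> 0 < z ->
  J theta (phi theta z) <= / nu theta z.
Proof.
  intros Ht Hz.
  assert (Hnu := nu_pos theta z (proj2 Ht) Hz).
  assert (H := weighted_sq_distance theta z _ Ht Hz (D1_phi theta z Ht Hz)).
  apply is_series_unique in H.
  rewrite (Series_ext _ (fun _ => 0 * 0)), Series_scal_l in H by (intros n; ring).
  assert (HA := D1_sq_pos _ (D1_phi theta z Ht Hz)). unfold J.
  set (A := sum1 (fun n => phi theta z n ^ 2)) in *.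
  assert (HB : 0 <= sum1 (fun n => (INR n - theta) ^ 2 * phi theta z n ^ 2)).
  { apply Rle_trans with ((INR 1 - theta) ^ 2 * phi theta z 1 ^ 2).
    - apply Rmult_le_pos; apply pow2_ge_0.
    - apply (term_le_Series (fun k => (INR (S k) - theta) ^ 2 * phi theta z (S k) ^ 2)).
      + intros n. apply Rmult_le_pos; apply pow2_ge_0.
      + apply D1_ex_series_shift; [lra|now apply D1_phi]. }
  set (B := sum1 (fun n => (INR n - theta) ^ 2 * phi theta z n ^ 2)) in *.
  assert (HsA := sqrt_sqrt A (Rlt_le _ _ HA)). assert (HsB := sqrt_sqrt B HB).
  assert (Hsq := pow2_ge_0 (sqrt A - z * sqrt B)).
  apply Rmult_le_reg_l with (2 * z); [lra|].
  replace (2 * z * / nu theta z) with (2 * z / nu theta z) by reflexivity.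
  nra.
Qed.

(* The scale [Z] balances the two terms of [A + Z^2 B] and so turns it into
   [2 Z J]; it is at most [1 / (1 - theta)] because [(1 - theta)^2 A <= B]. *)
Lemma carlson_defect (theta : R) (a : nat -> R) : 0 <= theta < 1 -> D1 a ->
  exists Z, 0 < Z <= 1 / (1 - theta) /\
    is_series (fun k => (1 + Z ^ 2 * (INR (S k) - theta) ^ 2) *
                        (a (S k) - phi theta Z (S k)) ^ 2)
      (2 * Z * (J theta a - / nu theta Z)).
Proof.
  intros Ht Ha.
  assert (HA := D1_sq_pos a Ha).
  assert (HAB : (1 - theta) ^ 2 * sum1 (fun n => a n ^ 2) <=
                sum1 (fun n => (INR n - theta) ^ 2 * a n ^ 2)).
  { unfold sum1. rewrite <- Series_scal_l. apply Series_le.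
    2:{ now apply D1_ex_series_shift. }
    intros n. split; [apply Rmult_le_pos; apply pow2_ge_0|].
    apply Rmult_le_compat_r; [apply pow2_ge_0|]. apply pow_incr.
    rewrite S_INR. assert (H := pos_INR n). lra. }
  assert (Hmain := fun z Hz => weighted_sq_distance theta z a Ht Hz Ha).
  unfold J.
  set (A := sum1 (fun n => a n ^ 2)) in *.
  set (B := sum1 (fun n => (INR n - theta) ^ 2 * a n ^ 2)) in *.
  assert (Ht2 : 0 < (1 - theta) ^ 2) by (apply pow_lt; lra).
  assert (HB : 0 < B) by nra.
  assert (HsA := sqrt_lt_R0 A HA). assert (HsB := sqrt_lt_R0 B HB).
  assert (EA := sqrt_sqrt A (Rlt_le _ _ HA)). assert (EB := sqrt_sqrt B (Rlt_le _ _ HB)).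
  assert (HZ : 0 < sqrt A / sqrt B) by now apply Rdiv_lt_0_compat.
  exists (sqrt A / sqrt B). split.
  - split; [exact HZ|]. apply Rle_div_l; [exact HsB|].
    replace (1 / (1 - theta) * sqrt B) with (sqrt B / (1 - theta)) by (field; lra).
    apply Rle_div_r; [lra|].
    apply Rnot_lt_le. intros Hlt.
    assert (sqrt B * sqrt B < (sqrt A * (1 - theta)) * (sqrt A * (1 - theta)))
      by (apply Rmult_le_0_lt_compat; lra).
    nra.
  - specialize (Hmain _ HZ).
    assert (Hnu := nu_pos theta _ (proj2 Ht) HZ).
    match type of Hmain with is_series _ ?l =>
      replace (2 * (sqrt A / sqrt B) * _) with l; [exact Hmain|] end.
    assert (E : (sqrt A / sqrt B) ^ 2 * B = A).
    { transitivity ((sqrt A / sqrt B) ^ 2 * (sqrt B * sqrt B)); [now rewrite EB|].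
      transitivity (sqrt A * sqrt A); [field; lra|exact EA]. }
    rewrite E.
    transitivity (2 * (sqrt A * sqrt A) - 2 * (sqrt A / sqrt B) / nu theta (sqrt A / sqrt B)).
    + rewrite EA. ring.
    + field. lra.
Qed.

(** Both conclusions come from one series of nonnegative terms: its sum is nonnegative, and a zero
    sum kills every term, whose weights are positive. *)
Lemma J_ge (theta : R) (a : nat -> R) : 0 <= theta < 1 -> D1 a ->
  exists Z, 0 < Z <= 1 / (1 - theta) /\ / nu theta Z <= J theta a /\
    (J theta a = / nu theta Z -> seq_eq a (phi theta Z)).
Proof.
  intros Ht Ha. destruct (carlson_defect theta a Ht Ha) as [Z [HZ Hs]].
  exists Z. split; [exact HZ|].
  set (u := fun k => (1 + Z ^ 2 * (INR (S k) - theta) ^ 2) *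
                     (a (S k) - phi theta Z (S k)) ^ 2) in *.
  assert (Hu : forall k, 0 <= u k).
  { intros k. apply Rmult_le_pos; [apply Rlt_le, weight_pos|apply pow2_ge_0]. }
  assert (Hle : forall k, u k <= 2 * Z * (J theta a - / nu theta Z)).
  { intros k. rewrite <- (is_series_unique _ _ Hs).
    apply term_le_Series; [exact Hu|]. eexists. exact Hs. }
  split.
  - assert (H := Rle_trans _ _ _ (Hu 0%nat) (Hle 0%nat)). nra.
  - intros E [|k] Hk; [lia|].
    assert (H := Hle k). rewrite E in H.
    assert (W := weight_pos Z (INR (S k) - theta)). unfold u in H.
    assert (Hsq := pow2_ge_0 (a (S k) - phi theta Z (S k))).
    assert (H0 : (a (S k) - phi theta Z (S k)) ^ 2 = 0) by nra.
    assert (H1 : a (S k) - phi theta Z (S k) = 0) by nra. lra.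
Qed.

Lemma J_seq_eq (theta : R) (a b : nat -> R) : seq_eq a b -> J theta a = J theta b.
Proof.
  intros H. unfold J, sum1.
  f_equal; f_equal; apply Series_ext; intros n; rewrite (H (S n)) by lia; reflexivity.
Qed.

(** * The supremum of [nu] and the infimum of [J] in the extended reals *)

(** The bound from [nu_le] excludes plus infinity and the value at the endpoint excludes minus
    infinity. *)
Lemma nubar_finite (theta : R) : 0 <= theta < 1 ->
  exists L, nubar theta = Finite L /\
    (forall z, 0 < z <= 1 / (1 - theta) -> nu theta z <= L) /\
    (forall M, (forall z, 0 < z <= 1 / (1 - theta) -> nu theta z <= M) -> L <= M).
Proof.
  intros Ht. unfold nubar.
  set (E := fun y => exists z : R, 0 < z <= 1 / (1 - theta) /\ y = nu theta z).
  assert (Hz0 : 0 < 1 / (1 - theta)) by (apply Rdiv_lt_0_compat; lra).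
  destruct (Lub_Rbar_correct E) as [Hub Hleast].
  assert (Hb : Rbar_le (Lub_Rbar E) (Finite (PI + 2 * (1 / (1 - theta))))).
  { apply Hleast. intros y [z [Hz ->]]. simpl.
    assert (H := nu_le theta z (proj2 Ht) (proj1 Hz)). lra. }
  assert (Hin : E (nu theta (1 / (1 - theta)))).
  { exists (1 / (1 - theta)). split; [lra|reflexivity]. }
  assert (H0 := Hub _ Hin).
  destruct (Lub_Rbar E) as [L| |]; simpl in Hb, H0; [|contradiction|contradiction].
  exists L. split; [reflexivity|]. split.
  - intros z Hz. apply (Hub (nu theta z)). now exists z.
  - intros M HM. apply (Hleast (Finite M)). intros y [z [Hz ->]]. now apply HM.
Qed.

Lemma Lub_open_eq_nubar (theta : R) : 0 <= theta < 1 ->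
  Lub_Rbar (fun y => exists z : R, 0 < z < 1 / (1 - theta) /\ y = nu theta z) = nubar theta.
Proof.
  intros Ht. apply is_lub_Rbar_unique.
  destruct (Lub_Rbar_correct (fun y => exists z : R, 0 < z <= 1 / (1 - theta) /\ y = nu theta z))
    as [Hub Hleast].
  split.
  - intros y [z [Hz ->]]. apply Hub. exists z. split; [lra|reflexivity].
  - intros b Hb. apply Hleast. intros y [z [Hz ->]].
    destruct (proj2 Hz) as [Hlt|Heq].
    + apply Hb. exists z. split; [lra|reflexivity].
    + destruct (nu_endpoint_lt theta Ht) as [w [Hw Hlt]].
      apply Rbar_le_trans with (Finite (nu theta w)).
      * rewrite Heq. simpl. lra.
      * apply Hb. now exists w.
Qed.

(** [J_ge] bounds [J] below because its scale lies in the range of the supremum; testing with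
    [phi theta z] for every [z] in that range shows that no larger lower bound exists. *)
Lemma mu_eq (theta L : R) : 0 <= theta < 1 ->
  (forall z, 0 < z <= 1 / (1 - theta) -> nu theta z <= L) ->
  (forall M, (forall z, 0 < z <= 1 / (1 - theta) -> nu theta z <= M) -> L <= M) ->
  mu theta = Finite (/ L).
Proof.
  intros Ht Hub Hleast.
  assert (Hz0 : 0 < 1 / (1 - theta)) by (apply Rdiv_lt_0_compat; lra).
  assert (HL : 0 < L).
  { apply Rlt_le_trans with (nu theta (1 / (1 - theta))); [apply nu_pos|apply Hub]; lra. }
  apply is_glb_Rbar_unique. split.
  - intros y [a [Ha ->]]. simpl.
    destruct (J_ge theta a Ht Ha) as [Z [HZ [HJ _]]].
    eapply Rle_trans; [|exact HJ].
    apply Rinv_le_contravar; [apply nu_pos; lra|now apply Hub].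
  - intros b Hb.
    assert (Hb' : forall z, 0 < z <= 1 / (1 - theta) -> Rbar_le b (Finite (/ nu theta z))).
    { intros z Hz. apply Rbar_le_trans with (Finite (J theta (phi theta z))).
      - apply Hb. exists (phi theta z). split; [apply D1_phi; lra|reflexivity].
      - simpl. apply J_phi_le; lra. }
    destruct b as [b| |]; simpl in *; [|now apply (Hb' (1 / (1 - theta))); lra|trivial].
    (* Passing to inverses needs a positive lower bound. *)
    destruct (Rle_lt_dec b 0) as [Hb0|Hb0].
    { apply Rle_trans with 0; [exact Hb0|]. apply Rlt_le. now apply Rinv_0_lt_compat. }
    rewrite <- (Rinv_inv b). apply Rinv_le_contravar; [exact HL|].
    apply Hleast. intros z Hz. rewrite <- (Rinv_inv (nu theta z)).
    apply Rinv_le_contravar; [exact Hb0|now apply Hb'].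
Qed.

(** A bound below PI contradicts [nu_ge_PI_sub] at a small [z]. The range (0, 1] lies in (0, 1 / (1
    - theta)] for every theta considered. *)
Lemma PI_le_of_nu_le (theta L : R) : 0 <= theta < 1 ->
  (forall z, 0 < z <= 1 -> nu theta z <= L) -> PI <= L.
Proof.
  intros Ht HL. apply Rnot_lt_le. intros Hlt.
  set (z := Rmin 1 ((PI - L) / 4)).
  assert (Hz : 0 < z) by (apply Rmin_pos; lra).
  assert (H1 : z <= 1) by apply Rmin_l.
  assert (H2 : z <= (PI - L) / 4) by apply Rmin_r.
  assert (H3 := nu_ge_PI_sub theta z (proj2 Ht) Hz).
  specialize (HL z (conj Hz H1)). nra.
Qed.

Theorem theorem1p3 :
  forall theta : R, 0 <= theta < 1 ->
    nubar theta =
      Lub_Rbar (fun y => exists z : R, 0 < z < 1 / (1 - theta) /\ y = nu theta z) /\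
    mu theta = Rbar_inv (nubar theta) /\
    (nubar theta = Finite PI <-> 0 <= theta <= 1 / 2) /\
    (0 <= theta <= 1 / 2 ->
       mu theta = Finite (1 / PI) /\
       forall a : nat -> R, D1 a -> Rbar_lt (mu theta) (Finite (J theta a))) /\
    (1 / 2 < theta < 1 ->
       Rbar_lt (mu theta) (Finite (1 / PI)) /\
       (exists z : R, maximizer theta z) /\
       forall a : nat -> R, D1 a ->
         (Finite (J theta a) = mu theta <->
          exists Z : R, maximizer theta Z /\ seq_eq a (phi theta Z))).
Proof.
  intros theta Ht.
  destruct (nubar_finite theta Ht) as [L [EL [Hub Hleast]]].
  assert (Emu := mu_eq theta L Ht Hub Hleast).
  assert (Hpi := PI_RGT_0).
  assert (Hz0 : 1 <= 1 / (1 - theta)) by (apply Rle_div_r; lra).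
  assert (HPL : PI <= L).
  { apply (PI_le_of_nu_le theta L Ht). intros z Hz. apply Hub. lra. }
  assert (Hlow : theta <= 1 / 2 -> L = PI).
  { intros Hle. apply Rle_antisym; [|exact HPL].
    apply Hleast. intros z Hz. apply Rlt_le, nu_lt_PI; lra. }
  assert (Hhigh : 1 / 2 < theta -> exists z, 0 < z <= 1 / (1 - theta) /\ PI < nu theta z).
  { intros Hlt. destruct (nu_gt_PI theta (conj Hlt (proj2 Ht))) as [z [Hz Hgt]].
    exists z. split; [lra|exact Hgt]. }
  assert (HhighL : 1 / 2 < theta -> PI < L).
  { intros Hlt. destruct (Hhigh Hlt) as [z [Hz Hgt]]. specialize (Hub z Hz). lra. }
  split; [symmetry; now apply Lub_open_eq_nubar|].
  split.
  { rewrite Emu, EL. reflexivity. }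
  split.
  { rewrite EL. split.
    - intros E. injection E as E. split; [lra|].
      apply Rnot_lt_le. intros Hlt. specialize (HhighL Hlt). lra.
    - intros Hle. now rewrite (Hlow (proj2 Hle)). }
  split.
  - intros Hle. rewrite Emu, (Hlow (proj2 Hle)). split.
    { f_equal. unfold Rdiv. ring. }
    intros a Ha. simpl.
    (* The supremum PI is not attained: [nu theta Z < PI] at the scale of [a] makes the inequality
       strict. *)
    destruct (J_ge theta a Ht Ha) as [Z [HZ [HJ _]]].
    eapply Rlt_le_trans; [|exact HJ].
    apply Rinv_0_lt_contravar; [apply nu_pos|apply nu_lt_PI]; lra.
  - intros Hlt. specialize (HhighL (proj1 Hlt)). rewrite Emu. split; [|split].
    + simpl. replace (1 / PI) with (/ PI) by (unfold Rdiv; ring).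
      apply Rinv_0_lt_contravar; lra.
    + destruct (Hhigh (proj1 Hlt)) as [z1 [Hz1 Hgt]].
      destruct (nu_max_exists theta z1 Ht Hz1 Hgt) as [Z [HZ Hmax]].
      exists Z. split; [exact HZ|]. rewrite EL. f_equal.
      apply Rle_antisym; [apply Hub; lra|now apply Hleast].
    + intros a Ha. split.
      * intros E. injection E as E.
        destruct (J_ge theta a Ht Ha) as [Z [HZ [HJ Heq]]].
        assert (Hnu := nu_pos theta Z (proj2 Ht) (proj1 HZ)).
        (* From 1 / nu(Z) <= J = 1 / L the scale [Z] must maximise [nu], so equality holds in [J_ge]
           and forces [a] to be [phi theta Z]. *)
        assert (EZ : nu theta Z = L).
        { apply Rle_antisym; [now apply Hub|].
          rewrite <- (Rinv_inv L), <- (Rinv_inv (nu theta Z)).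
          apply Rinv_le_contravar; [apply Rinv_0_lt_compat; lra|lra]. }
        exists Z. split; [|apply Heq; now rewrite EZ].
        split; [|now rewrite EL, EZ].
        split; [lra|]. destruct (proj2 HZ) as [HZlt|HZeq]; [exact HZlt|].
        (* A maximum at the endpoint would be exceeded at an interior point. *)
        destruct (nu_endpoint_lt theta Ht) as [w [Hw Hwlt]].
        rewrite <- HZeq, EZ in Hwlt.
        specialize (Hub w ltac:(lra)). lra.
      * intros [Z [[HZ EZ] Heq]]. rewrite EL in EZ. injection EZ as EZ.
        f_equal. apply Rle_antisym.
        -- rewrite (J_seq_eq theta _ _ Heq), <- EZ. apply J_phi_le; lra.
        -- destruct (J_ge theta a Ht Ha) as [W [HW [HJ _]]].
           eapply Rle_trans; [|exact HJ].
           apply Rinv_le_contravar; [apply nu_pos; lra|now apply Hub].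
Qed.
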